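(* Assume $\widehat A_h\in\mathbb{R}^{M_h\times n_h}$, $M_h\ge n_h$, has full column rank. Suppose $\widetilde e_\theta\in\mathbb{R}^{n_h}$ approximates the exact correction $e_\theta$ solving $\widehat H_he_\theta=\widehat A_h^\top W_hr_h$, and define the linear-solve residual $\eta_h^{\mathrm{prim}}:=\widehat A_h^\top W_hr_h-\widehat H_h\widetilde e_\theta$. Assume that $$\delta_h^{\mathrm{prim}}\ge\left((\eta_h^{\mathrm{prim}})^\top\widehat H_h^{-1}\eta_h^{\mathrm{prim}}\right)^{1/2}.$$ Define $\widetilde c_{i,h}^{\mathrm{corr,prim}}:=\ell_{i,h}^\top(U_\theta-Z_h\widetilde e_\theta)$. Then $$\left|\widetilde c_{i,h}^{\mathrm{corr,prim}}-\ell_{i,h}^\top U_h^\star\right|\le\sigma_{i,h}\delta_h^{\mathrm{prim}}.$$ Consequently, if $U_h^\pi=U_{0,h}+Z_hy_h^\pi$ is an admissible comparison vector and $T_h\ge\|A_hU_h^\pi-b_h\|_{W_h}$, $\varepsilon_{i,h}^{\mathrm{eval}}\ge|\ell_{i,h}^\top U_h^\pi-u^\star(x_i)|$, then $$u^\star(x_i)\in\left[\widetilde c_{i,h}^{\mathrm{corr,prim}}-\sigma_{i,h}(\delta_h^{\mathrm{prim}}+T_h)-\varepsilon_{i,h}^{\mathrm{eval}},\;\widetilde c_{i,h}^{\mathrm{corr,prim}}+\sigma_{i,h}(\delta_h^{\mathrm{prim}}+T_h)+\varepsilon_{i,h}^{\mathrm{eval}}\right].$$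
   Context: $u^\star$ is the exact solution (unique in its admissible class) of a boundary-value problem on a bounded domain, with $u^\star(x_i)$ well defined at the query point $x_i$. Let $U_{0,h}\in\mathbb{R}^{N_h}$ and let $Z_h\in\mathbb{R}^{N_h\times n_h}$ have full column rank. Let $A_h\in\mathbb{R}^{M_h\times N_h}$, $b_h\in\mathbb{R}^{M_h}$, $\widehat A_h:=A_hZ_h$, $\widehat b_h:=b_h-A_hU_{0,h}$. Let $W_h\in\mathbb{R}^{M_h\times M_h}$ be symmetric positive definite, $\|r\|_{W_h}:=(r^\top W_hr)^{1/2}$, $\|g\|_{W_h^{-1}}:=(g^\top W_h^{-1}g)^{1/2}$, $\widehat H_h:=\widehat A_h^\top W_h\widehat A_h$. The discrete target is $U_h^\star:=U_{0,h}+Z_hy_h^\star$ with $y_h^\star:=\arg\min_y\frac12\|\widehat A_hy-\widehat b_h\|_{W_h}^2$ (equal to $\widehat A_h^{-1}\widehat b_h$ when $M_h=n_h$). $U_\theta=U_{0,h}+Z_hy_\theta$ is an arbitrary admissible vector with residual $r_h:=A_hU_\theta-b_h$. For the query vector $\ell_{i,h}\in\mathbb{R}^{N_h}$, $q_{i,h}$ solves $\widehat H_hq_{i,h}=Z_h^\top\ell_{i,h}$, $g_{i,h}:=W_h\widehat A_hq_{i,h}$, $\sigma_{i,h}:=\|g_{i,h}\|_{W_h^{-1}}$. *)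

(* Defs.v *)
From HB Require Import structures.
From mathcomp Require Import all_boot all_order all_algebra.
From mathcomp Require Import boolp classical_sets reals topology normedtype.

Set Implicit Arguments.
Unset Strict Implicit.
Unset Printing Implicit Defensive.

Import Order.TTheory GRing.Theory Num.Theory.
Import numFieldNormedType.Exports.

Local Open Scope classical_set_scope.
Local Open Scope ring_scope.

(* The equation and the boundary condition are arbitrary predicates on
   functions, so that strong, weak and variational formulations are all
   covered.  Candidates are honest functions with point values, not classes
   modulo a.e. equality; only their values on the closure of the domain are
   relevant. *)
Record bvp (R : realType) (d : nat) := BVP {
  bvp_domain : set 'rV[R]_d;
  bvp_domain_open : open bvp_domain;
  bvp_domain_connected : connected bvp_domain;
  bvp_domain_nonempty : bvp_domain !=set0;
  bvp_domain_bounded : bounded_set bvp_domain;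
  bvp_admissible : set ('rV[R]_d -> R);
  bvp_equation : set ('rV[R]_d -> R);
  bvp_boundary_condition : set ('rV[R]_d -> R) }.

Definition bvp_solution (R : realType) (d : nat) (P : bvp R d)
    (u : 'rV[R]_d -> R) : Prop :=
  [/\ bvp_admissible P u, bvp_equation P u & bvp_boundary_condition P u].

Definition bvp_exact_solution (R : realType) (d : nat) (P : bvp R d)
    (u : 'rV[R]_d -> R) : Prop :=
  bvp_solution P u /\
  forall v, bvp_solution P v ->
    forall x, closure (bvp_domain P) x -> v x = u x.

Definition dotv (R : realType) (m : nat) (u v : 'cV[R]_m) : R :=
  (u^T *m v) 0 0.

Definition sym_posdef (R : realType) (m : nat) (W : 'M[R]_m) : Prop :=
  W^T = W /\ forall v : 'cV[R]_m, v != 0 -> 0 < dotv v (W *m v).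

Definition wnorm (R : realType) (m : nat) (W : 'M[R]_m) (r : 'cV[R]_m) : R :=
  Num.sqrt (dotv r (W *m r)).

Definition is_argmin (R : realType) (T : Type) (J : T -> R) (y : T) : Prop :=
  forall z, J y <= J z.

(* Main.v *)
(** By the normal equations [Ahat^T W (Ahat ystar - bhat) = 0], the linear-solve
    residual is [eta = Hhat w] with [w = ytheta - etilde - ystar], and the error
    of a query at [U0 + Z y] is [l^T Z (y - ystar) = <Ahat q, Ahat (y - ystar)>_W].
    Since [sigma] is the [W]-norm of [Ahat q] and the [Hhat^-1]-norm of [eta] is
    the [W]-norm of [Ahat w], both bounds are instances of the Cauchy-Schwarz
    inequality for [W]; for the comparison vector, orthogonality first replaces
    [Ahat (ypi - ystar)] by the residual [Ahat ypi - bhat]. *)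

Require Import Defs.
From HB Require Import structures.
From mathcomp Require Import all_boot all_order all_algebra.
From mathcomp Require Import boolp classical_sets reals topology normedtype.
From mathcomp Require Import ring lra.

Set Implicit Arguments.
Unset Strict Implicit.
Unset Printing Implicit Defensive.

Import Order.TTheory GRing.Theory Num.Theory.
Import numFieldNormedType.Exports.

Local Open Scope classical_set_scope.
Local Open Scope ring_scope.

Section Dotv.
Variables (R : realType) (m : nat).
Implicit Types (u v w : 'cV[R]_m) (c : R).

Lemma dotvC u v : dotv u v = dotv v u.
Proof. by rewrite /dotv -[in LHS](trmxK v) -trmx_mul mxE. Qed.

Lemma dotvDl u v w : dotv (u + v) w = dotv u w + dotv v w.
Proof. by rewrite /dotv linearD /= mulmxDl mxE. Qed.

Lemma dotvZl c u v : dotv (c *: u) v = c * dotv u v.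
Proof. by rewrite /dotv linearZ /= -scalemxAl mxE. Qed.

Lemma dotvDr u v w : dotv u (v + w) = dotv u v + dotv u w.
Proof. by rewrite /dotv mulmxDr mxE. Qed.

Lemma dotvBr u v w : dotv u (v - w) = dotv u v - dotv u w.
Proof. by rewrite /dotv mulmxBr !mxE. Qed.

Lemma dotvZr c u v : dotv u (c *: v) = c * dotv u v.
Proof. by rewrite /dotv -scalemxAr mxE. Qed.

Lemma dotv_eq0 u : dotv u u = 0 -> u = 0.
Proof.
rewrite /dotv mxE => /eqP; rewrite psumr_eq0 => [/allP u0|i _]; last first.
  by rewrite mxE -expr2 sqr_ge0.
apply/colP => i; rewrite mxE.
by have := u0 i (mem_index_enum i); rewrite /= mxE mulf_eq0 orbb => /eqP.
Qed.

End Dotv.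

Lemma dotv_mulmx (R : realType) (m n : nat) (M : 'M[R]_(m, n))
    (u : 'cV[R]_m) (v : 'cV[R]_n) : dotv u (M *m v) = dotv (M^T *m u) v.
Proof. by rewrite /dotv trmx_mul trmxK mulmxA. Qed.

Section WeightedInnerProduct.
Variables (R : realType) (m : nat) (W : 'M[R]_m).
Hypothesis W_posdef : sym_posdef W.
Implicit Types u v : 'cV[R]_m.

Lemma posdef_ge0 v : 0 <= dotv v (W *m v).
Proof.
have [->|v0] := eqVneq v 0; last exact/ltW/W_posdef.2.
by rewrite /dotv !mulmx0 mxE.
Qed.

Lemma posdef_eq0 v : W *m v = 0 -> v = 0.
Proof.
move=> Wv0; apply/eqP/contraT => /(W_posdef.2).
by rewrite Wv0 /dotv mulmx0 mxE ltxx.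
Qed.

(** Definiteness makes [W] injective on columns; symmetry carries this over to the rows that
    [inj_row_free] asks about. *)
Lemma posdef_unitmx : W \in unitmx.
Proof.
rewrite -row_free_unit; apply/inj_row_free => v vW0; apply: trmx_inj.
by rewrite trmx0; apply: posdef_eq0; rewrite -W_posdef.1 -trmx_mul vW0 trmx0.
Qed.

Lemma dotv_weightC u v : dotv u (W *m v) = dotv v (W *m u).
Proof. by rewrite dotv_mulmx W_posdef.1 dotvC. Qed.

Lemma wnorm_ge0 v : 0 <= wnorm W v.
Proof. exact: sqrtr_ge0. Qed.

Lemma wnorm_sqr v : wnorm W v ^+ 2 = dotv v (W *m v).
Proof. by rewrite sqr_sqrtr // posdef_ge0. Qed.

Lemma wnorm_addZ_sqr u v (c : R) :
  wnorm W (u + c *: v) ^+ 2 =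
  wnorm W u ^+ 2 + 2 * c * dotv v (W *m u) + c ^+ 2 * wnorm W v ^+ 2.
Proof.
rewrite !wnorm_sqr mulmxDr -scalemxAr !(dotvDl, dotvDr, dotvZl, dotvZr).
by rewrite (dotv_weightC u v); ring.
Qed.

Lemma wnorm_cauchy_schwarz u v :
  `|dotv u (W *m v)| <= wnorm W u * wnorm W v.
Proof.
have [->|v0] := eqVneq v 0.
  by rewrite mulmx0 /dotv mulmx0 mxE normr0 mulr_ge0 ?wnorm_ge0.
have Qv : 0 < wnorm W v ^+ 2 by rewrite wnorm_sqr W_posdef.2.
rewrite -ler_sqr ?nnegrE ?mulr_ge0 ?wnorm_ge0 // real_normK ?num_real //.
rewrite exprMn -subr_ge0.
(* The vector is [u] minus its [W]-orthogonal projection on [v]; expanding its squared norm gives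
   the discriminant form of the inequality. The division by [wnorm W v ^+ 2] is why [v = 0] was
   treated apart. *)
have := sqr_ge0 (wnorm W (u + (- (dotv u (W *m v) / wnorm W v ^+ 2)) *: v)).
rewrite wnorm_addZ_sqr (dotv_weightC v u).
set c := dotv _ _; set a := wnorm W v ^+ 2 in Qv *; set s := wnorm W u ^+ 2.
have -> : s + 2 * - (c / a) * c + (- (c / a)) ^+ 2 * a = (s * a - c ^+ 2) / a.
  by field; rewrite gt_eqF.
by rewrite pmulr_lge0 ?invr_gt0.
Qed.

(** Turns dual norms into primal ones: with the weight [W] it evaluates [sigma], with the weight
    [Hhat] the norm of [eta]. *)
Lemma wnorm_invmx_mul u : wnorm (invmx W) (W *m u) = wnorm W u.
Proof. by rewrite /wnorm mulKmx ?posdef_unitmx // dotvC. Qed.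

End WeightedInnerProduct.

Section LeastSquares.
Variables (R : realType) (m n : nat) (W : 'M[R]_m) (B : 'M[R]_(m, n)).
Hypothesis W_posdef : sym_posdef W.
Implicit Types (y : 'cV[R]_n) (f : 'cV[R]_m).

Lemma dotv_gram (u v : 'cV[R]_n) :
  dotv u (B^T *m W *m B *m v) = dotv (B *m u) (W *m (B *m v)).
Proof. by rewrite -!mulmxA dotv_mulmx trmxK. Qed.

Lemma wnorm_gram v : wnorm (B^T *m W *m B) v = wnorm W (B *m v).
Proof. by rewrite /wnorm dotv_gram. Qed.

(** Full column rank provides a left inverse of [B], so [B *m v] is nonzero whenever [v] is, and
    definiteness of [W] applies to it. *)
Lemma gram_posdef : \rank B = n -> sym_posdef (B^T *m W *m B).
Proof.
move=> rB; split; first by rewrite !trmx_mul trmxK W_posdef.1 mulmxA.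
move=> v v0; rewrite dotv_gram; apply: W_posdef.2.
apply: contraNneq v0 => Bv0.
have /row_fullP[B' B'B] : row_full B by rewrite /row_full rB.
by rewrite -[v]mul1mx -B'B -mulmxA Bv0 mulmx0.
Qed.

(** First-order optimality without derivatives: [y] is perturbed along the gradient [x] itself. The
    linear coefficient of the resulting quadratic in [t] is, up to the factor 2, [dotv x x], and
    minimality forces it to vanish. *)
Lemma least_squares_normal_eq y f :
  is_argmin (fun z => 2^-1 * wnorm W (B *m z - f) ^+ 2) y ->
  B^T *m W *m (B *m y - f) = 0.
Proof.
move=> ymin; set x := _ *m _; apply: dotv_eq0.
have -> : dotv x x = dotv (B *m x) (W *m (B *m y - f)).
  by rewrite {2}/x -mulmxA dotv_mulmx trmxK.
have line (t : R) : 0 <= 2 * t * dotv (B *m x) (W *m (B *m y - f))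
                         + t ^+ 2 * wnorm W (B *m x) ^+ 2.
  have /= := ymin (y + t *: x).
  by rewrite [B *m (y + _)]mulmxDr -scalemxAr addrAC wnorm_addZ_sqr //; lra.
move: line; set c := dotv _ _; set s := wnorm _ _ ^+ 2 => line.
have s0 : 0 <= s by exact: sqr_ge0.
have s1 : 0 < s + 1 by lra.
(* The parabola has its minimum at [- (c / s)]; the denominator [s + 1] also covers [s = 0] and
   still gives a negative value unless [c = 0]. *)
have := line (- (c / (s + 1))).
have -> : 2 * - (c / (s + 1)) * c + (- (c / (s + 1))) ^+ 2 * s
          = - (c ^+ 2 * (s + 2)) / (s + 1) ^+ 2 by field; rewrite gt_eqF.
rewrite pmulr_lge0 ?invr_gt0 ?exprn_gt0 // oppr_ge0 pmulr_lle0; last by lra.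
by move=> c0; apply/eqP; rewrite -sqrf_eq0 eq_le c0 sqr_ge0.
Qed.

End LeastSquares.

Theorem propositionB10 (R : realType)
    (d : nat) (P : bvp R d) (ustar : 'rV[R]_d -> R) (xi : 'rV[R]_d)
    (Nh Mh nh : nat)
    (U0 : 'cV[R]_Nh) (Z : 'M[R]_(Nh, nh))
    (A : 'M[R]_(Mh, Nh)) (b : 'cV[R]_Mh) (W : 'M[R]_Mh)
    (ystar ytheta : 'cV[R]_nh) (l : 'cV[R]_Nh)
    (q etheta etilde : 'cV[R]_nh) (delta : R) :
  let Ahat : 'M[R]_(Mh, nh) := A *m Z in
  let bhat : 'cV[R]_Mh := b - A *m U0 in
  let Hhat : 'M[R]_nh := Ahat^T *m W *m Ahat in
  let Ustar : 'cV[R]_Nh := U0 + Z *m ystar in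
  let Utheta : 'cV[R]_Nh := U0 + Z *m ytheta in
  let r : 'cV[R]_Mh := A *m Utheta - b in
  let g : 'cV[R]_Mh := W *m Ahat *m q in
  let sigma : R := wnorm (invmx W) g in
  let eta : 'cV[R]_nh := Ahat^T *m W *m r - Hhat *m etilde in
  let ccorr : R := dotv l (Utheta - Z *m etilde) in
  bvp_exact_solution P ustar ->
  closure (bvp_domain P) xi ->
  \rank Z = nh ->
  sym_posdef W ->
  (nh <= Mh)%N ->
  \rank Ahat = nh ->
  is_argmin (fun y : 'cV[R]_nh => 2^-1 * wnorm W (Ahat *m y - bhat) ^+ 2)
    ystar ->
  Hhat *m q = Z^T *m l ->
  Hhat *m etheta = Ahat^T *m W *m r ->
  wnorm (invmx Hhat) eta <= delta ->
  `|ccorr - dotv l Ustar| <= sigma * delta /\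
  (forall (ypi : 'cV[R]_nh) (T eps : R),
     let Upi : 'cV[R]_Nh := U0 + Z *m ypi in
     wnorm W (A *m Upi - b) <= T ->
     `|dotv l Upi - ustar xi| <= eps ->
     ustar xi \in `[ccorr - sigma * (delta + T) - eps,
                    ccorr + sigma * (delta + T) + eps]).
Proof.
move=> Ahat bhat Hhat Ustar Utheta r g sigma eta ccorr _ _ _ Wpd _ rAhat ymin.
move=> Hq _ eta_delta.
have Hpd : sym_posdef Hhat by exact: gram_posdef.
have normal : Ahat^T *m W *m (Ahat *m ystar - bhat) = 0.
  exact: least_squares_normal_eq ymin.
have residualE y : A *m (U0 + Z *m y) - b = Ahat *m y - bhat.
  by rewrite mulmxDr mulmxA opprB addrCA addrA.
(* [q] is the Riesz representer of the query functional for the inner product of [Hhat]. *)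
have queryE y : dotv l (Z *m y) = dotv (Ahat *m q) (W *m (Ahat *m y)).
  by rewrite dotv_mulmx -Hq dotvC dotv_gram dotv_weightC.
have sigmaE : sigma = wnorm W (Ahat *m q).
  by rewrite /sigma /g -mulmxA wnorm_invmx_mul.
have sigma0 : 0 <= sigma by rewrite sigmaE wnorm_ge0.
have etaE : eta = Hhat *m (ytheta - etilde - ystar).
  rewrite /eta /r /Utheta residualE.
  (* The optimal residual is split off, since [normal] annihilates it; this eliminates [bhat]. *)
  rewrite -[Ahat *m ytheta - bhat](subrK (Ahat *m ystar - bhat)) mulmxDr normal.
  rewrite addr0 [- (Ahat *m _ - _)]opprB addrA subrK -mulmxBr mulmxA -mulmxBr.
  by rewrite addrAC.
have corr_error : `|ccorr - dotv l Ustar| <= sigma * delta.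
  rewrite -dotvBr /Utheta /Ustar.
  have -> : U0 + Z *m ytheta - Z *m etilde - (U0 + Z *m ystar)
            = Z *m (ytheta - etilde - ystar).
    by rewrite -[U0 + _ - _]addrA -mulmxBr opprD addrACA subrr add0r -mulmxBr.
  rewrite queryE; apply: le_trans (wnorm_cauchy_schwarz Wpd _ _) _.
  rewrite -sigmaE ler_wpM2l // -wnorm_gram.
  by move: eta_delta; rewrite etaE wnorm_invmx_mul.
split=> // ypi T eps Upi res_T query_eps.
have comparison_error : `|dotv l Upi - dotv l Ustar| <= sigma * T.
  rewrite -dotvBr /Upi /Ustar opprD addrACA subrr add0r -mulmxBr queryE.
  have -> : dotv (Ahat *m q) (W *m (Ahat *m (ypi - ystar)))
            = dotv (Ahat *m q) (W *m (Ahat *m ypi - bhat)).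
    have -> : Ahat *m (ypi - ystar)
              = (Ahat *m ypi - bhat) - (Ahat *m ystar - bhat).
      by rewrite mulmxBr [- (Ahat *m _ - _)]opprB addrA subrK.
    (* Moving [Ahat] to the other side of the second product exposes the left side of [normal], so
       that term is zero. *)
    rewrite [W *m _]mulmxBr dotvBr dotvC -[X in _ - X]dotvC.
    rewrite [X in _ - X]dotv_mulmx mulmxA normal.
    by rewrite [X in _ - X]/dotv trmx0 mul0mx mxE subr0 dotvC.
  apply: le_trans (wnorm_cauchy_schwarz Wpd _ _) _.
  by rewrite -sigmaE ler_wpM2l // -residualE.
(* Triangle inequality from [ccorr] to [ustar xi] through [dotv l Ustar] and [dotv l Upi]. *)
move: corr_error comparison_error query_eps.
rewrite in_itv /= !ler_norml => /andP[? ?] /andP[? ?] /andP[? ?].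
by apply/andP; split; lra.
Qed.
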